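(* Set $\alpha_0=1/\sqrt2$ and $\beta_0=1/12$. For every integer $n\ge1$, with $p=4^n+1$, there exist a closed polyhedral convex cone $C\subset\mathbb{R}^p$, with $A=C\cap\mathbb{S}^{p-1}$, and a centered random vector $Z\in\mathbb{R}^p$ (that is, $\mathbb{E}Z=0$) such that: (i) $Z$ has finite covariance, polynomial tails (in every standard coordinate), and an infinite fourth moment in every standard coordinate, i.e. $\mathbb{E}|Z_k|^4=\infty$ for every coordinate $Z_k$ of $Z$; (ii) $Z$ satisfies the global small-ball condition $$\inf_{v\in\mathbb{R}^p\setminus\{0\}}\mathbb{P}\bigl(|\langle Z,v\rangle|\ge\alpha_0\|v\|_2\bigr)\ge\beta_0;$$ (iii) $w(A)<2$; and (iv) if $X\in\mathbb{R}^{n\times p}$ has $n$ independent copies of $Z$ as rows, then $$\mathbb{P}\left(\inf_{u\in A}\|Xu\|_2^2=0\right)\ge 1-\exp(-2^n).$$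
   Context: $\mathbb{S}^{p-1}=\{u\in\mathbb{R}^p:\|u\|_2=1\}$. For $A\subset\mathbb{S}^{p-1}$, the (one-sided) Gaussian width is $w(A):=\mathbb{E}\sup_{u\in A}\langle g,u\rangle$ with $g\sim N(0,I_p)$. A closed polyhedral convex cone is the set of all nonnegative linear combinations of finitely many vectors. A random vector $Z$ has polynomial tails (in every standard coordinate) if for each coordinate $Z_k$ there are constants $0<c\le c'<\infty$, $\kappa>0$, $t_0>0$ (possibly depending on $k$ and on the law of $Z$) with $c\,t^{-\kappa}\le\mathbb{P}(|Z_k|\ge t)\le c'\,t^{-\kappa}$ for all $t\ge t_0$. *)

(* Defs.v *)
From HB Require Import structures.
From mathcomp Require Import all_boot all_order all_algebra.
From mathcomp Require Import all_classical all_reals all_analysis.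

Set Implicit Arguments.
Unset Strict Implicit.
Unset Printing Implicit Defensive.

Import Order.TTheory GRing.Theory Num.Theory.
Import numFieldNormedType.Exports.

Local Open Scope classical_set_scope.
Local Open Scope ring_scope.

(* Matrices carry the sigma-algebra generated by their entries, as the library
   does for tuples; over a realType this is the Borel sigma-algebra. *)
Definition measure_matrix_display : measure_display -> measure_display.
Proof. exact. Qed.

Section measurable_matrix.
Context {d : measure_display} {T : measurableType d} (m n : nat).

Definition measurable_entries : set (set 'M[T]_(m, n)) :=
  [set S | exists i j (B : set T), measurable B /\ S = [set M : 'M[T]_(m, n) | B (M i j)]].

Let matrix_set0 : <<s measurable_entries >> set0.
Proof. exact: sigma_algebra0. Qed.

Let matrix_setC S :
  <<s measurable_entries >> S -> <<s measurable_entries >> (~` S).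
Proof. exact: sigma_algebraC. Qed.

Let matrix_bigcup (F : (set 'M[T]_(m, n))^nat) :
  (forall i, <<s measurable_entries >> (F i)) ->
  <<s measurable_entries >> (\bigcup_i F i).
Proof. exact: sigma_algebra_bigcup. Qed.

HB.instance Definition _ := @isMeasurable.Build (measure_matrix_display d)
  'M[T]_(m, n) <<s measurable_entries >> matrix_set0 matrix_setC matrix_bigcup.

End measurable_matrix.

Section euclidean_space.
Context {R : realType} {p : nat}.

Definition inner (u v : 'cV[R]_p) : R := \sum_(i < p) u i 0 * v i 0.

(* The library's norm `|u| on matrices is the sup norm. *)
Definition norm2 (u : 'cV[R]_p) : R := Num.sqrt (\sum_(i < p) u i 0 ^+ 2).

Definition unit_sphere : set 'cV[R]_p := [set u | norm2 u = 1].

Definition polyhedral_cone (C : set 'cV[R]_p) : Prop :=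
  exists (m : nat) (V : 'I_m -> 'cV[R]_p),
    C = [set u | exists2 a : 'I_m -> R,
                   (forall i, 0 <= a i) & u = \sum_(i < m) a i *: V i].

End euclidean_space.

Section random_vectors.
Context {d : measure_display} {T : measurableType d} {R : realType}.
Variable P : probability T R.

(* The product rule for subfamilies of the finite index type I is the case
   where the remaining B i are setT. *)
Definition mutually_independent (I : finType) (d' : measure_display)
    (E : measurableType d') (X : I -> T -> E) : Prop :=
  forall B : I -> set E, (forall i, measurable (B i)) ->
    P [set w | forall i, B i (X i w)] =
    (\prod_(i : I) P [set w | B i (X i w)])%E.

Definition standard_gaussian (p : nat) (g : {RV P >-> 'cV[R]_p}) : Prop :=
  mutually_independent (fun (i : 'I_p) w => g w i 0) /\
  forall (i : 'I_p) (B : set R), measurable B ->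
    P [set w | B (g w i 0)] = normal_prob 0 1 B.

(* Supremum and infimum are taken in \bar R, so that they are -oo and +oo on
   the empty set rather than the default value 0 of the real-valued ones. *)
Definition gaussian_width (p : nat) (g : {RV P >-> 'cV[R]_p})
    (A : set 'cV[R]_p) : \bar R :=
  (\int[P]_w ereal_sup [set (inner (g w) u)%:E | u in A])%E.

Definition inf_sqnorm (n p : nat) (M : 'M[R]_(n, p)) (A : set 'cV[R]_p) :
    \bar R :=
  ereal_inf [set (norm2 (M *m u) ^+ 2)%:E | u in A].

Section one_vector.
Context {p : nat}.
Variable Z : {RV P >-> 'cV[R]_p}.

(* If Z k is not integrable, its expectation is infinite. *)
Definition centered : Prop := forall k : 'I_p, ('E_P[fun w => (Z w k 0)%R] = 0)%E.

(* For j = k a finite value forces E (Z k)^2 < +oo, hence the integrability of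
   all the products (Z j) (Z k). *)
Definition finite_covariance : Prop := forall j k : 'I_p,
  covariance P (fun w => Z w j 0) (fun w => Z w k 0) \is a fin_num.

Definition polynomial_tails : Prop := forall k : 'I_p,
  exists c c' kappa t0 : R, [/\ 0 < c, c <= c', 0 < kappa, 0 < t0 &
    forall t : R, t0 <= t ->
      let tail := P [set w | t <= `|Z w k 0|] in
      ((c * t `^ (- kappa))%R%:E <= tail)%E /\
      (tail <= (c' * t `^ (- kappa))%R%:E)%E].

Definition infinite_fourth_moment : Prop := forall k : 'I_p,
  ('E_P[fun w => (`|Z w k 0| ^+ 4)%R] = +oo)%E.

Definition small_ball (alpha beta : R) : Prop :=
  (beta%:E <= ereal_inf
    [set P [set w | (alpha * norm2 v <= `|inner (Z w) v|)%R]
       | v in [set v | v != 0%R]])%E.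

End one_vector.

End random_vectors.

Arguments standard_gaussian {d T R} P {p} g.
Arguments gaussian_width {d T R} P {p} g A.
Arguments centered {d T R} P {p} Z.
Arguments finite_covariance {d T R} P {p} Z.
Arguments polynomial_tails {d T R} P {p} Z.
Arguments infinite_fourth_moment {d T R} P {p} Z.
Arguments small_ball {d T R} P {p} Z alpha beta.

(* The rows of X are n independent copies of Z; X and Z may live on different
   probability spaces. *)
Definition rows_iid_copies {R : realType} {n p : nat}
    {d : measure_display} {T : measurableType d} (P : probability T R)
    (Z : {RV P >-> 'cV[R]_p})
    {d' : measure_display} {T' : measurableType d'} (P' : probability T' R)
    (X : {RV P' >-> 'M[R]_(n, p)}) : Prop :=
  mutually_independent P' (fun (i : 'I_n) w => (row i (X w))^T) /\
  forall (i : 'I_n) (B : set 'cV[R]_p), measurable B ->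
    P' [set w | B (row i (X w))^T] = P [set w | B (Z w)].

Arguments rows_iid_copies {R n p d T} P Z {d' T'} P' X.

(* Main.v *)
Require Import Defs.
From HB Require Import structures.
From mathcomp Require Import all_boot all_order all_algebra.
From mathcomp Require Import all_classical all_reals all_analysis.
From mathcomp Require Import measurable_realfun normal_distribution ring lra.

Import Order.TTheory GRing.Theory Num.Theory.
Import numFieldNormedType.Exports.

Local Open Scope classical_set_scope.
Local Open Scope ring_scope.

(** Write N = 4^n. The cone C is spanned by the vectors N e_0 + e_j, j < N, and
    Z = ± 2^k (1, ± N, ..., ± N) with independent fair signs and an independent
    level k of law (7/8) 8^-k. A unit vector of C has e_0-coordinate at most 1
    and other coordinates of sum at most 1/N, so that x <= exp(x - 1) bounds
    <g, u> by exp(g_0 - 1) + (1/N) \sum_j exp(g_j - 1), of expectation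
    2 exp(-1/2) < 2. The small-ball bound is the Paley-Zygmund inequality with
    E S^4 <= 3 (E S^2)^2 for weighted sums S of signs. A row of X is orthogonal
    to N e_0 + e_j with probability 1/2, independently over j, hence no
    generator is in the kernel of X with probability
    (1 - 2^-n)^(4^n) <= exp(-2^n). The event inf = 0 is measurable because
    {M | |M u|^2 < e for some u in A} is open, thus a countable union of
    rational boxes. *)

(** * Moments and anticoncentration of weighted sums of random signs *)

Section random_signs.
Context {R : realFieldType} {I : finType}.
Implicit Types (r : {ffun I -> bool}) (s : seq I) (a : R) (b : I -> R).

Definition flip_at (i : I) r : {ffun I -> bool} := [ffun j => (j == i) (+) r j].

Lemma flip_atK i : involutive (flip_at i).
Proof. by move=> r; apply/ffunP => j; rewrite !ffunE addKb. Qed.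

(** Flipping the sign at [i] permutes the patterns, fixes [h] and negates every term. *)
Lemma sum_sign_odd (i : I) (h : {ffun I -> bool} -> R) :
  (forall r, h (flip_at i r) = h r) -> \sum_(r : {ffun I -> bool}) (-1) ^+ r i * h r = 0.
Proof.
move=> hflip; set S := \sum_(r : {ffun I -> bool}) _; suff : S = - S by lra.
rewrite {1}/S (reindex_inj (inv_inj (flip_atK i))) -sumrN.
by apply: eq_bigr => r _; rewrite hflip ffunE eqxx /= signrN mulNr.
Qed.

Definition sign_sum a b s r : R := a + \sum_(i <- s) (-1) ^+ r i * b i.

Definition sq_weight a b s : R := a ^+ 2 + \sum_(i <- s) b i ^+ 2.

Local Notation M := (#|{ffun I -> bool}|%:R : R).

Lemma sign_sum_flip a b s i r : i \notin s ->
  sign_sum a b s (flip_at i r) = sign_sum a b s r.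
Proof.
move=> iNs; congr (a + _); apply: eq_big_seq => j js.
by rewrite ffunE (negbTE (memPn iNs j js)).
Qed.

Lemma sign_sum_cons a b i s r :
  sign_sum a b (i :: s) r = sign_sum a b s r + (-1) ^+ r i * b i.
Proof. by rewrite /sign_sum big_cons; ring. Qed.

Lemma sq_weight_cons a b i s : sq_weight a b (i :: s) = sq_weight a b s + b i ^+ 2.
Proof. by rewrite /sq_weight big_cons; ring. Qed.

Lemma sq_weight_ge0 a b s : 0 <= sq_weight a b s.
Proof. by rewrite addr_ge0 ?sqr_ge0 ?sumr_ge0// => i _; rewrite sqr_ge0. Qed.

Lemma sum_cst (c : R) : \sum_(r : {ffun I -> bool}) c = M * c.
Proof. by rewrite sumr_const mulr_natl. Qed.

Lemma sign_sqr r i : (-1) ^+ r i * (-1) ^+ r i = 1 :> R.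
Proof. by rewrite -signr_addb addbb. Qed.

(** Induction on [s]: the cross term is odd in the new sign and sums to zero. Uniqueness of [s]
    keeps the earlier partial sum invariant under that flip. *)
Lemma sum_sign_sum2 a b s : uniq s ->
  \sum_(r : {ffun I -> bool}) sign_sum a b s r ^+ 2 = M * sq_weight a b s.
Proof.
elim: s => [_|i s IH /= /andP[iNs /IH {}IH]].
  rewrite -sum_cst; apply: eq_bigr => r _.
  by rewrite /sign_sum /sq_weight !big_nil !addr0.
rewrite sq_weight_cons mulrDr -IH -sum_cst.
rewrite -[RHS]addr0.
rewrite -[X in _ = _ + X](@sum_sign_odd i (fun r => 2 * b i * sign_sum a b s r)).
  rewrite -!big_split/=; apply: eq_bigr => r _; rewrite sign_sum_cons.
  by have := sign_sqr r i; set e := (-1) ^+ _ => ee; ring: ee.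
by move=> r; rewrite sign_sum_flip.
Qed.

(** The odd terms cancel, leaving S^4 + 6 b_i^2 S^2 + b_i^4. The induction closes since 3 q^2 + 6
    b_i^2 q + b_i^4 <= 3 (q + b_i^2)^2. *)
Lemma sum_sign_sum4 a b s : uniq s ->
  \sum_(r : {ffun I -> bool}) sign_sum a b s r ^+ 4 <= M * (3 * sq_weight a b s ^+ 2).
Proof.
elim: s => [_|i s IH /= /andP[iNs us]].
  rewrite -sum_cst; apply: ler_sum => r _.
  rewrite /sign_sum /sq_weight !big_nil !addr0.
  by have := sqr_ge0 (a ^+ 2); lra.
have -> : \sum_(r : {ffun I -> bool}) sign_sum a b (i :: s) r ^+ 4 =
    \sum_(r : {ffun I -> bool}) sign_sum a b s r ^+ 4 +
    6 * b i ^+ 2 * (\sum_(r : {ffun I -> bool}) sign_sum a b s r ^+ 2) + M * b i ^+ 4.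
  rewrite -[RHS]addr0 -[X in _ = _ + X](@sum_sign_odd i (fun r =>
    4 * b i * sign_sum a b s r ^+ 3 + 4 * b i ^+ 3 * sign_sum a b s r)).
    rewrite -sum_cst mulr_sumr -!big_split/=; apply: eq_bigr => r _.
    rewrite sign_sum_cons.
    by have := sign_sqr r i; set e := (-1) ^+ _ => ee; ring: ee.
  by move=> r; rewrite sign_sum_flip.
rewrite sum_sign_sum2// sq_weight_cons.
apply: le_trans (_ : M * (3 * sq_weight a b s ^+ 2 +
  6 * b i ^+ 2 * sq_weight a b s + b i ^+ 4) <= _).
  by have := IH us; lra.
rewrite ler_wpM2l//; have := sqr_ge0 (b i ^+ 2).
by set x := b i; set q := sq_weight _ _ _; nra.
Qed.

(* Paley-Zygmund in the pointwise form 1_{x >= 1/2} >= (x - 1/2 - x^2/12)/3. *)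
Lemma card_sign_sum_ge a b s : uniq s ->
  M <= 12 * #|[pred r : {ffun I -> bool} |
    sq_weight a b s <= 2 * sign_sum a b s r ^+ 2]|%:R.
Proof.
move=> us; set q := sq_weight a b s.
have [q0|q_neq0] := eqVneq q 0.
  rewrite [X in _ <= _ * X%:R](@eq_card _ _ predT) => [|r]; last first.
    by rewrite !inE q0 mulr_ge0 ?sqr_ge0.
  by have : 0 <= M by []; lra.
have q_gt0 : 0 < q by rewrite lt_def q_neq0 sq_weight_ge0.
set G := [pred r : {ffun I -> bool} | _].
(* The pointwise inequality at x = S^2 / q, multiplied by 36 q^2. Summing over [r] leaves (12 - 6 -
   3) q^2 = 3 q^2 per pattern on the left, whence the constant 12. *)
have pw r : sign_sum a b s r ^+ 2 * (12 * q) - 6 * q ^+ 2 - sign_sum a b s r ^+ 4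
    <= 36 * q ^+ 2 * (G r)%:R.
  rewrite /G /=; move: (sign_sum a b s r) => x.
  case: (leP q (2 * x ^+ 2)) => xq /=.
    by have := sqr_ge0 (x ^+ 2 - 6 * q); have := sqr_ge0 q; nra.
  by have := sqr_ge0 (x ^+ 2); nra.
have := @ler_sum R _ (index_enum {ffun I -> bool}) predT _ _ (fun r _ => pw r).
rewrite !sumrB -mulr_suml sum_sign_sum2// sum_cst -mulr_sumr -natr_sum.
rewrite (_ : (\sum_(r : {ffun I -> bool}) G r)%N = #|G|); last first.
  rewrite -sum1_card [RHS]big_mkcond; apply: eq_bigr => r _.
  by rewrite unfold_in /=; case: (_ <= _).
have := @sum_sign_sum4 a b s us; rewrite -/q => h4 h.
have : M * q ^+ 2 <= 12 * #|G|%:R * q ^+ 2 by lra.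
by rewrite ler_pM2r// exprn_gt0.
Qed.

End random_signs.

(* Measurable types are pointed in the library, whence the argument [t0]. *)
Definition discrete {T : choiceType} (t0 : T) : Type := T.

Section discrete_sigma_algebra.
Context {T : choiceType} (t0 : T).

HB.instance Definition _ := Choice.on (discrete t0).
HB.instance Definition _ := isPointed.Build (discrete t0) t0.
HB.instance Definition _ := @isMeasurable.Build
  default_measure_display (discrete t0) discrete_measurable
  (@discrete_measurable0 T) (@discrete_measurableC T) (@discrete_measurableU T).

End discrete_sigma_algebra.

(** * The law of a geometric level with an independent uniform label *)

Section geometric_mixture.
Context {R : realType} {F : finType} (x0 : F).
Local Notation T := (discrete (0%N, x0)).

(** The factor 7/8 normalises the series of 8^-k; the division by [#|F|] spreads the mass of a level
    evenly over the labels. *)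
Definition geom_weight (k : nat) : {nonneg R} :=
  (7 / 8 / 8 ^+ k / #|F|%:R)%:nng.

Definition geom_slice (k i : nat) : {measure set T -> \bar R} :=
  dirac ((k, nth x0 (enum F) i) : T).

Definition geom_unif : set T -> \bar R :=
  mseries (fun k => mscale (geom_weight k) (msum (geom_slice k) #|F|)) 0.

HB.instance Definition _ := Measure.on geom_unif.

Local Open Scope ereal_scope.

Lemma measurable_fun_discrete d (E : measurableType d) (f : T -> E) (A : set T) :
  measurable_fun A f.
Proof. by []. Qed.

Lemma integral_geom_unif (f : T -> \bar R) : (forall t, 0 <= f t) ->
  \int[geom_unif]_t f t =
  \sum_(k <oo) ((geom_weight k)%:num%:E * \sum_(x : F) f (k, x)).
Proof.
move=> f0; rewrite /geom_unif ge0_integral_measure_series//.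
apply: eq_eseriesr => k _; rewrite ge0_integral_mscale//; congr (_ * _).
rewrite ge0_integral_measure_sum//.
transitivity (\sum_(i < #|F|) f (k, nth x0 (enum F) i)).
  apply: eq_bigr => i _; rewrite integral_dirac// diracE in_setT mul1e//.
rewrite -[RHS]big_enum/= (big_nth x0) -cardE big_mkord //.
Qed.

Lemma nneseries_geom_tail (k0 : nat) :
  \sum_(k <oo) (if (k0 <= k)%N then 7 / 8 / 8 ^+ k else 0 : R)%:E =
  (8 ^- k0)%:E.
Proof.
(* Partial sums are taken up to m + k0, where they have the closed form 8^-k0 (1 - 8^-m). *)
apply/cvg_lim => //; rewrite -(cvg_shiftn k0)/=.
under eq_fun => m.
  rewrite sumEFin (_ : (\sum_(0 <= i < m + k0) _)%R = (8 ^- k0 * (1 - 8^-1 ^+ m))%R :> R).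
    over.
  elim: m => [|m IH].
    rewrite add0n expr0 subrr mulr0 big_nat big1// => i /andP[_ ik].
    by rewrite leqNgt ik.
  rewrite addSn big_nat_recr//= IH leq_addl exprD !exprVn exprS.
  have k8 : (8 ^+ k0 : R)%R != 0%R by rewrite expf_neq0.
  have m8 : (8 ^+ m : R)%R != 0%R by rewrite expf_neq0.
  field. by rewrite k8 m8.
apply: cvg_EFin; first exact: nearW.
suff: ((8 ^- k0 : R) * (1 - 8^-1 ^+ m) @[m --> \oo] --> (8 ^- k0 * (1 - 0) : R))%R.
  by rewrite subr0 mulr1.
apply: cvgMr; apply: cvgB; first exact: cvg_cst.
by apply: cvg_expr; rewrite ger0_norm// invf_lt1// ltr1n.
Qed.

(** This one formula serves for the total mass, for the coordinate tails (trivial [G]) and for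
    events on the signs alone ([k0] = 0). *)
Lemma geom_unif_tail (k0 : nat) (G : pred F) :
  geom_unif [set t : T | (k0 <= t.1)%N && G t.2] =
  (8 ^- k0 * (#|G|%:R / #|F|%:R))%R%:E.
Proof.
rewrite EFinM -nneseries_geom_tail muleC -nneseriesZl; last first.
  by move=> k _; case: ifP => // _; rewrite lee_fin divr_ge0.
rewrite /geom_unif /mseries; apply: eq_eseriesr => k _.
rewrite /mscale /msum /=.
transitivity ((7 / 8 / 8 ^+ k / #|F|%:R)%R%:E *
   \sum_(x : F) (((k0 <= k)%N && G x)%:R : R)%R%:E).
  congr (_ * _); rewrite -[RHS]big_enum/= (big_nth x0) -cardE big_mkord.
  by apply: eq_bigr => i _; rewrite /geom_slice /= diracE mem_setE.
rewrite sumEFin -EFinM -natr_sum; case: (k0 <= k)%N => /=; last first.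
  by rewrite big1// mulr0 mule0.
rewrite (_ : (\sum_(x : F) G x)%N = #|G|); last first.
  rewrite -sum1_card [RHS]big_mkcond/=; apply: eq_bigr => x _.
  by rewrite unfold_in; case: (G x).
by rewrite -EFinM mulrC -!mulrA; congr (_%:E); ring.
Qed.

Let Fgt0 : (0 < #|F|%:R :> R)%R.
Proof. by rewrite ltr0n; apply/card_gt0P; exists x0. Qed.

Let weight_sum k (c : R) :
  ((geom_weight k)%:num * (\sum_(x : F) c) = 7 / 8 / 8 ^+ k * c)%R.
Proof.
rewrite sumr_const -[(c *+ _)%R]mulr_natl [LHS]mulrA; congr (_ * _)%R.
by rewrite /= mulfVK ?gt_eqF.
Qed.

Let geom_unif_setT : geom_unif setT = 1.
Proof.
have := geom_unif_tail 0 predT; rewrite (_ : [set _ | _] = setT).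
  by move=> ->; rewrite expr0 invr1 mul1r divff// gt_eqF.
by apply/seteqP; split.
Qed.

HB.instance Definition _ :=
  Measure_isProbability.Build _ _ _ geom_unif geom_unif_setT.

(** Growth 4^k against mass 8^-k leaves a series dominated by c 2^-k, written as 2 c / 2^(k+1) to
    match the geometric series of ratio 1/2. *)
Lemma integrable_geom_unif (f : T -> R) (c : R) :
  (forall t, `|f t| <= c * 4 ^+ t.1)%R -> geom_unif.-integrable setT (EFin \o f).
Proof.
move=> fc; apply/integrableP; split => //.
rewrite integral_geom_unif//.
have c0 : (0 <= c)%R by have := fc (0%N, x0); rewrite expr0 mulr1; exact: le_trans.
apply: (@le_lt_trans _ _ (\sum_(k <oo) ((2 * c) / (2 ^ (k + 1))%:R)%R%:E)).
  apply: lee_nneseries => [k _|k _]; first by rewrite mule_ge0 ?sume_ge0.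
  rewrite sumEFin -EFinM lee_fin.
  have -> : (2 * c / (2 ^ (k + 1))%:R = (8 ^+ k)^-1 * (c * 4 ^+ k))%R.
    have k4 : (4 ^+ k != 0 :> R)%R by rewrite expf_neq0.
    have k2 : (2 ^+ k != 0 :> R)%R by rewrite expf_neq0.
    have -> : (8 = 2 * 4 :> R)%R by ring.
    by rewrite natrX exprD exprMn; field; rewrite k2 k4.
  rewrite (@le_trans _ _ ((geom_weight k)%:num%R * (\sum_(x : F) c * 4 ^+ k)%R)%R)//.
    by rewrite ler_wpM2l// ler_sum// => x _; exact: fc.
  rewrite weight_sum ler_wpM2r ?mulr_ge0//.
  by rewrite ler_piMl// ler_pdivrMr// mul1r ler_nat.
have /cvg_lim -> // := @cvg_geometric_eseries_half R (2 * c)%R 0; exact: ltry.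
Qed.

(** At each level [phi] permutes the equally likely labels and exchanges the positive and negative
    parts. Their integrals agree, and integrability makes the difference 0 rather than oo - oo. *)
Lemma expectation_geom_unif_odd (f : T -> R) (phi : F -> F) :
  geom_unif.-integrable setT (EFin \o f) -> involutive phi ->
  (forall k x, f (k, phi x) = - f (k, x))%R ->
  \int[geom_unif]_t (f t)%:E = 0.
Proof.
move=> intf phiK fphi.
have /= E := integralE geom_unif setT (EFin \o f).
rewrite E.
have -> : \int[geom_unif]_t ((EFin \o f)^\+ t) = \int[geom_unif]_t ((EFin \o f)^\- t).
  rewrite !integral_geom_unif//; apply: eq_eseriesr => k _; congr (_ * _).
  rewrite (reindex_inj (inv_inj phiK)); apply: eq_bigr => x _.
  by rewrite funeposE funenegE/= fphi EFinN.
rewrite subee//.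
exact: (integrable_neg_fin_num measurableT intf).
Qed.

Lemma integral_geom_unif_pinfty (f : T -> R) :
  (forall t, 16 ^+ t.1 <= f t)%R ->
  \int[geom_unif]_t (f t)%:E = +oo.
Proof.
move=> f16; have f0 t : (0 <= f t)%R by rewrite (le_trans _ (f16 t)).
rewrite integral_geom_unif//; apply/eqyP => A A0.
(* Each level contributes at least (7/8) 2^k >= 1/2, so more than 2 A levels exceed [A]. *)
pose m := (Num.truncn (2 * A)).+1.
apply: le_trans (nneseries_lim_ge m _); last first.
  by move=> k _ _; rewrite mule_ge0 ?sume_ge0// => x _; rewrite lee_fin.
rewrite (@le_trans _ _ (\sum_(0 <= k < m) 2^-1%R%:E))//.
  rewrite sumEFin lee_fin sumr_const_nat subn0 -[(_ *+ m)%R]mulr_natr.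
  by rewrite ler_pdivlMl// ltW// truncnS_gt.
apply: lee_sum => k _; rewrite sumEFin -EFinM lee_fin.
rewrite (@le_trans _ _ ((geom_weight k)%:num%R * (\sum_(x : F) 16 ^+ k)%R)%R)//.
  rewrite weight_sum.
  have -> : (16 = 8 * 2 :> R)%R by ring.
  rewrite exprMn mulrA mulfVK ?expf_neq0//.
  have : (1 <= 2 ^+ k :> R)%R by rewrite exprn_ege1// ler1n.
  lra.
by rewrite ler_wpM2l// ler_sum// => x _; exact: (f16 (k, x)).
Qed.

End geometric_mixture.

(** * Integration tools for the Gaussian width *)

Section nonneg_majorant.
Local Open Scope ereal_scope.
Context {d : measure_display} {T : measurableType d} {R : realType}.
Variable P : {measure set T -> \bar R}.

Import HBNNSimple.

(* Measurability plays no role, since the integral of a nonnegative function is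
   a supremum over its simple minorants. *)
Lemma integral_le_majorant (f h : T -> \bar R) :
  (forall w, 0 <= h w) -> (forall w, f w <= h w) ->
  \int[P]_w f w <= \int[P]_w h w.
Proof.
move=> h0 fh; rewrite integralE.
apply: (@le_trans _ _ (\int[P]_w (f^\+) w)).
  by rewrite geeDl ?oppe_le0 ?integral_ge0.
rewrite !ge0_integralTE//; apply: ereal_sup_le => _ [g gf <-].
exists g => // w; apply: le_trans (gf w) _.
by rewrite funeposE ge_max fh h0.
Qed.

End nonneg_majorant.

Section normal_integral.
Local Open Scope ereal_scope.
Context {R : realType}.
Local Notation mu := (@lebesgue_measure R).

(** The Radon-Nikodym derivative and the density have the same integral over every measurable set,
    so they agree almost everywhere. *)
Lemma ge0_integral_normal_prob (m s : R) (f : measurableTypeR R -> \bar R) :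
  (forall x, 0 <= f x) -> measurable_fun setT f ->
  \int[normal_prob m s]_x f x = \int[mu]_x (f x * (normal_pdf m s x)%:E).
Proof.
move=> f0 mf.
have dom := @normal_prob_dominates R m s.
rewrite -(Radon_Nikodym_SigmaFinite.change_of_variables dom)//.
have iRN := Radon_Nikodym_SigmaFinite.f_integrable dom.
have mpdf : measurable_fun setT (EFin \o normal_pdf m s).
  by apply/measurable_EFinP; exact: measurable_normal_pdf.
apply: ae_eq_integral => //.
- by apply: emeasurable_funM => //; exact: measurable_int iRN.
- exact: emeasurable_funM.
- apply: ae_eqe_mul2l; apply: integral_ae_eq => // A _ mA.
  by rewrite -Radon_Nikodym_SigmaFinite.f_integral.
Qed.

(* e^(x-1) times the N(0,1) density is e^(-1/2) times the N(1,1) density. *)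
Lemma integral_normal_expR :
  \int[normal_prob (0 : R) 1]_x (expR (x - 1))%:E = (expR (- 2^-1))%:E.
Proof.
rewrite ge0_integral_normal_prob; last 2 first.
- by move=> x; rewrite lee_fin expR_ge0.
- apply/measurable_EFinP; apply: measurableT_comp => //.
  exact: measurable_funB.
under eq_integral => x _.
  rewrite (_ : _ * _ = (expR (- 2^-1))%:E * (normal_pdf 1 1 x)%:E); last first.
    rewrite -!EFinM !normal_pdfE// /normal_fun; congr EFin.
    rewrite mulrCA [RHS]mulrCA -!expRD; congr (_ * expR _)%R.
    by rewrite expr1n; field.
  over.
rewrite integralZl//; last exact: integrable_normal_pdf.
by rewrite integral_normal_pdf mule1.
Qed.

End normal_integral.

Section matrix_coordinates.
Context {d : measure_display} {T : measurableType d} {m n : nat}.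

Lemma measurable_coord (i : 'I_m) (j : 'I_n) :
  measurable_fun setT (fun M : 'M[T]_(m, n) => M i j).
Proof.
move=> _ B mB; rewrite setTI; apply: sub_sigma_algebra.
by exists i, j, B.
Qed.

End matrix_coordinates.

(** * The cone and its Gaussian width *)

Section simplicial_cone.
Context {R : realType} {N : nat}.
Implicit Types (K : R) (a : 'I_N -> R).

(** The coordinate e_0 of the overview is stored last, at [rshift N 0], and e_j at [lshift 1 j]. *)
Definition cone_gen K (j : 'I_N) : 'cV[R]_(N + 1) :=
  col_mx (delta_mx j 0) (const_mx K).

Definition cone_point K a : 'cV[R]_(N + 1) :=
  col_mx (\col_j a j) (const_mx (K * \sum_j a j)).

Definition cone K : set 'cV[R]_(N + 1) :=
  [set u | exists2 a : 'I_N -> R,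
     (forall j, 0 <= a j) & u = \sum_(j < N) a j *: cone_gen K j].

Lemma cone_pointE K a : \sum_(j < N) a j *: cone_gen K j = cone_point K a.
Proof.
apply/colP => i; rewrite summxE; case: (split_ordP i) => k ->.
  rewrite col_mxEu mxE (bigD1 k)//= big1 ?addr0.
    by rewrite mxE col_mxEu mxE !eqxx mulr1.
  by move=> j jk; rewrite mxE col_mxEu mxE eq_sym (negbTE jk) mulr0.
rewrite col_mxEd mxE mulr_sumr; apply: eq_bigr => j _.
by rewrite mxE col_mxEd mxE mulrC.
Qed.

Lemma inner_cone_point K a (g : 'cV[R]_(N + 1)) :
  inner g (cone_point K a) =
  \sum_j g (lshift 1 j) 0 * a j + g (rshift N 0) 0 * (K * \sum_j a j).
Proof.
rewrite /inner big_split_ord/= big_ord1; congr (_ + _).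
  by apply: eq_bigr => j _; rewrite col_mxEu mxE.
by rewrite col_mxEd mxE.
Qed.

(** Only the last coordinate is kept in the norm. On the sphere this bounds the total weight by 1 /
    K. *)
Lemma norm2_cone_point_ge K a : 0 < K -> (forall j, 0 <= a j) ->
  K * \sum_j a j <= norm2 (cone_point K a).
Proof.
move=> K0 a0; rewrite /norm2 big_split_ord/= big_ord1.
have s0 : 0 <= K * \sum_j a j by rewrite mulr_ge0 ?sumr_ge0 ?ltW.
rewrite -(ger0_norm s0) -sqrtr_sqr.
rewrite ler_wsqrtr// col_mxEd mxE lerDr sumr_ge0// => j _.
exact: sqr_ge0.
Qed.

Lemma mulr_le_expR (x y : R) : 0 <= y -> x * y <= expR (x - 1) * y.
Proof.
by move=> y0; rewrite ler_wpM2r//; have := expR_ge1Dx (x - 1); rewrite addrC subrK.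
Qed.

(** Coordinates of [g] are first replaced by nonnegative exponentials; the weights K \sum_j a_j <= 1
    and a_j <= 1 / K can then be replaced by their upper bounds. *)
Lemma inner_cone_le K (g u : 'cV[R]_(N + 1)) : 0 < K ->
  (cone K `&` unit_sphere) u ->
  inner g u <= expR (g (rshift N 0) 0 - 1) +
               K^-1 * \sum_j expR (g (lshift 1 j) 0 - 1).
Proof.
move=> K0 [[a a0 ->]]; rewrite cone_pointE /unit_sphere /= => u1.
have sum_ge0 : 0 <= \sum_j a j by rewrite sumr_ge0.
have sum_le : K * \sum_j a j <= 1 by rewrite -u1 norm2_cone_point_ge.
rewrite inner_cone_point addrC lerD//.
  apply: le_trans (mulr_le_expR _ _ _) _; first by rewrite mulr_ge0 ?(ltW K0).
  by rewrite ler_piMr// expR_ge0.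
rewrite mulr_sumr ler_sum// => j _.
apply: le_trans (mulr_le_expR _ _ (a0 j)) _; rewrite mulrC ler_wpM2r ?expR_ge0//.
rewrite -[leRHS]mul1r ler_pdivlMr// mulrC (le_trans _ sum_le)// ler_wpM2l ?(ltW K0)//.
by rewrite (bigD1 j)//= lerDl sumr_ge0.
Qed.

Lemma polyhedral_cone_cone K : polyhedral_cone (cone K).
Proof. by exists N, (cone_gen K). Qed.

End simplicial_cone.

Section gaussian_width_bound.
Context {R : realType} {N : nat}.
Context {d : measure_display} {T : measurableType d} {P : probability T R}.
Local Open Scope ereal_scope.

Lemma gaussian_expR p (g : {RV P >-> 'cV[R]_p}) (i : 'I_p) :
  standard_gaussian P g ->
  \int[P]_w (expR (g w i 0 - 1))%:E = (expR (- 2^-1))%:E.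
Proof.
move=> [_ gauss]; rewrite -integral_normal_expR.
have mgR : measurable_fun setT (fun w => g w i 0%R).
  by apply: (measurableT_comp (measurable_coord i 0%R)).
(* The canonical sigma-algebra of R and that of [measurableTypeR R] have the
   same measurable sets but different displays. *)
have mg : @measurable_fun _ _ T (measurableTypeR R) setT (fun w => g w i 0%R).
  by move=> mD B mB; exact: mgR.
have mexp : measurable_fun setT (fun x : measurableTypeR R => (expR (x - 1))%:E).
  by apply/measurable_EFinP; apply: measurableT_comp => //; exact: measurable_funB.
have expo_ge0 : {in [set: measurableTypeR R], forall x, 0 <= (expR (x - 1))%:E}.
  by move=> x _; rewrite lee_fin expR_ge0.
have /esym := ge0_integral_pushforward mg P measurableT mexp expo_ge0.
rewrite preimage_setT => ->.
by apply: eq_measure_integral => A mA _; rewrite -[RHS](gauss i A mA).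
Qed.

Lemma gaussian_width_cone (g : {RV P >-> 'cV[R]_(N + 1)}) (K : R) :
  (0 < K)%R -> standard_gaussian P g ->
  gaussian_width P g (cone K `&` unit_sphere) <=
  ((1 + N%:R / K) * expR (- 2^-1))%:E.
Proof.
move=> K0 gauss; rewrite /gaussian_width.
have mg i : measurable_fun setT (fun w => (expR (g w i 0 - 1))%:E).
  apply/measurable_EFinP; apply: measurableT_comp => //; apply: measurable_funB => //.
  by apply: (measurableT_comp (measurable_coord i 0%R)).
(* [h] does not depend on u, so it dominates the supremum over the sphere section of the cone;
   [integral_le_majorant] spares the measurability of that supremum. *)
pose h w := (expR (g w (rshift N 0%R) 0 - 1))%:E +
     \sum_(j < N) (K^-1)%:E * (expR (g w (lshift 1 j) 0 - 1))%:E.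
apply: le_trans (@integral_le_majorant _ _ _ P _ h _ _) _.
- move=> w; rewrite adde_ge0 ?sume_ge0// => j _.
  by rewrite -EFinM lee_fin mulr_ge0 ?expR_ge0// invr_ge0 ltW.
- move=> w; apply: ub_ereal_sup => _ [u Au <-].
  rewrite /h; under eq_bigr do rewrite -EFinM.
  by rewrite sumEFin -EFinD lee_fin -mulr_sumr inner_cone_le.
have pos j w : 0 <= (K^-1)%:E * (expR (g w (lshift 1 j) 0 - 1))%:E.
  by rewrite -EFinM lee_fin mulr_ge0 ?expR_ge0 ?invr_ge0 ?ltW.
have mK (j : 'I_N) : measurable_fun setT
    (fun w => (K^-1)%:E * (expR (g w (lshift 1 j) 0 - 1))%:E).
  exact: emeasurable_funM.
rewrite /h ge0_integralD//=; last 2 first.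
- by move=> w _; rewrite sume_ge0.
- exact: emeasurable_sum.
rewrite ge0_integral_sum//.
under eq_bigr => j _.
  rewrite ge0_integralZl// ?lee_fin ?invr_ge0 ?(ltW K0)//.
  rewrite gaussian_expR//.
  over.
rewrite gaussian_expR//; under eq_bigr do rewrite -EFinM.
rewrite sumEFin -EFinD lee_fin sumr_const card_ord -[(_ *+ N)%R]mulr_natl.
by rewrite le_eqVlt; apply/orP; left; apply/eqP; ring.
Qed.

End gaussian_width_bound.

(** * Borel sets of matrices and measurability of the event inf = 0 *)

Section matrix_borel.
Context {R : realType} {m n : nat}.

Definition rational_box (Q : 'M[rat]_(m, n)) (k : nat) : set 'M[R]_(m, n) :=
  \bigcap_(ij : 'I_m * 'I_n)
    [set M | `|M ij.1 ij.2 - ratr (Q ij.1 ij.2)| < k.+1%:R^-1].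

Lemma measurable_rational_box Q k : measurable (rational_box Q k).
Proof.
apply: fin_bigcap_measurable => [|[i j] _] /=; first exact: finite_finset.
have mf : measurable_fun setT (fun M : 'M[R]_(m, n) => `|M i j - ratr (Q i j)|).
  apply: measurableT_comp => //; apply: measurable_funB => //.
  exact: measurable_coord.
rewrite [X in measurable X](_ : _ = setT `&`
  (fun M : 'M[R]_(m, n) => `|M i j - ratr (Q i j)|) @^-1` `]-oo, k.+1%:R^-1[).
  by apply: mf => //; exact: measurable_itv.
by rewrite setTI; apply/seteqP; split => M /=; rewrite in_itv.
Qed.

Lemma open_measurable_mx (U : set 'M[R]_(m, n)) : open U -> measurable U.
Proof.
move=> oU.
have -> : U = \bigcup_(Qk : 'M[rat]_(m, n) * nat)
    (if pselect (rational_box Qk.1 Qk.2 `<=` U) then rational_box Qk.1 Qk.2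
     else set0).
  apply/seteqP; split => [M UM|M [[Q k] _] /=]; last first.
    by case: pselect => // QU; exact: QU.
  have /nbhs_ballP[e /= e0 eU] : nbhs M U by exact: open_nbhs_nbhs.
  (* With radius below e / 2, any box containing [M] lies in the ball of radius e around [M]. *)
  have [k] := ltr_add_invr (divr_gt0 e0 (ltr0n R 2)).
  rewrite add0r => ke.
  have approx i j : exists q : rat, `|M i j - ratr q| < k.+1%:R^-1.
    have : M i j - k.+1%:R^-1 < M i j + k.+1%:R^-1.
      by rewrite ltrBlDr -addrA ltrDl addr_gt0.
    move=> /rat_in_itvoo[q]; rewrite in_itv/= => /andP[q1 q2]; exists q.
    by rewrite ltr_distlC; apply/andP; split => //; rewrite ltrBlDr -?ltrBlDr.
  pose Q := \matrix_(i, j) sval (cid (approx i j)).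
  have MQ : rational_box Q k M by move=> [i j] _ /=; rewrite mxE; case: cid.
  exists (Q, k) => //=; case: pselect => // -[] M' QM'; apply: eU; split => // i j.
  have h1 : `|M i j - ratr (Q i j)| < k.+1%:R^-1 := MQ (i, j) I.
  have h2 : `|M' i j - ratr (Q i j)| < k.+1%:R^-1 := QM' (i, j) I.
  apply: le_lt_trans (ler_distD (ratr (Q i j)) _ _) _.
  by rewrite [X in _ + X]distrC (splitr e) ltrD // (lt_trans _ ke).
apply: countable_bigcupT_measurable => [|[Q k]]; first exact: countableP.
by case: pselect => [QU|nQU] /=; [exact: measurable_rational_box|exact: measurable0].
Qed.

Lemma norm2_sqr (u : 'cV[R]_m) : norm2 u ^+ 2 = \sum_(i < m) u i 0 ^+ 2.
Proof. by rewrite sqr_sqrtr// sumr_ge0// => i _; rewrite sqr_ge0. Qed.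

Lemma continuous_sqnorm (u : 'cV[R]_n) :
  continuous (fun M : 'M[R]_(m, n) => norm2 (M *m u) ^+ 2).
Proof.
rewrite (_ : (fun _ => _) =
    (fun M : 'M[R]_(m, n) => \sum_(i < m) (\sum_(j < n) M i j * u j 0) ^+ 2)).
  apply: continuous_big => [|i _]; first exact: add_continuous.
  have ci : continuous (fun M : 'M[R]_(m, n) => \sum_(j < n) M i j * u j 0).
    apply: continuous_big => [|j _]; first exact: add_continuous.
    have cM : continuous (fun M : 'M[R]_(m, n) => M i j).
      exact: coord_continuous.
    by move=> M; apply: (continuousM (cM M)); exact: cst_continuous.
  by move=> M; apply: (continuousM (ci M)); exact: ci.
apply/funext => M; rewrite sqr_sqrtr; last by rewrite sumr_ge0// => i _; rewrite sqr_ge0.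
by apply: eq_bigr => i _; rewrite mxE.
Qed.

(** The thresholds 1 / (k + 1) account for an infimum that may not be attained, and they turn the
    event into a countable intersection. *)
Lemma inf_sqnorm_eq0P (A : set 'cV[R]_n) (M : 'M[R]_(m, n)) :
  inf_sqnorm M A = 0%E <->
  (forall k : nat, exists2 u, A u & norm2 (M *m u) ^+ 2 < k.+1%:R^-1).
Proof.
have ge0 : (0 <= inf_sqnorm M A)%E.
  by apply: le_ereal_inf_tmp => _ [u _ <-]; rewrite lee_fin sqr_ge0.
split=> [inf0 k|small].
  have /ereal_inf_lt[_ [u Au <-]] : (inf_sqnorm M A < k.+1%:R^-1%:E)%E.
    by rewrite inf0 lte_fin.
  by rewrite lte_fin => ?; exists u.
apply/eqP; rewrite eq_le ge0 andbT; apply/lee_addgt0Pr => e e0.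
have [k] := ltr_add_invr e0; rewrite !add0r => ke.
have [u Au uk] := small k.
apply: le_trans (ereal_inf_lbound _) _; first by exists u.
by rewrite lee_fin ltW// (lt_trans uk).
Qed.

Lemma measurable_inf_sqnorm_eq0 (A : set 'cV[R]_n) :
  measurable [set M : 'M[R]_(m, n) | inf_sqnorm M A = 0%E].
Proof.
rewrite (_ : mkset _ = \bigcap_k \bigcup_(u in A)
    ((fun M => norm2 (M *m u) ^+ 2) @^-1` [set x | x < k.+1%:R^-1])).
  (* The union over u in [A] may be uncountable, so its measurability comes from openness. *)
  apply: bigcapT_measurable => k; apply: open_measurable_mx.
  apply: bigcup_open => u _; apply: open_comp; last exact: open_lt.
  by move=> M _; exact: continuous_sqnorm.
apply/seteqP; split => M /=.
  by move=> /inf_sqnorm_eq0P h k _; have [u] := h k; exists u.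
by move=> h; apply/inf_sqnorm_eq0P => k; have [u] := h k I; exists u.
Qed.

End matrix_borel.

(** * Counting sign patterns with a constant column *)

Section sign_patterns.

(** After transposition the condition is imposed column by column: each of the [#|J|] columns avoids
    the single pattern [full]. *)
Lemma card_no_full_column (I J : finType) :
  #|[pred rho : {ffun I -> {ffun J -> bool}} | ~~ [exists j, [forall i, rho i j]]]|
  = ((2 ^ #|I|).-1 ^ #|J|)%N.
Proof.
pose tr (A B : finType) (f : {ffun A -> {ffun B -> bool}}) :=
  [ffun b => [ffun a => f a b]] : {ffun B -> {ffun A -> bool}}.
have trK A B : cancel (@tr A B) (@tr B A).
  by move=> f; apply/ffunP => a; apply/ffunP => b; rewrite !ffunE.
pose full : {ffun I -> bool} := [ffun=> true].
transitivity #|[pred g : {ffun J -> {ffun I -> bool}} | g \in ffun_on (predC1 full)]|.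
  rewrite -!sum1_card (reindex (@tr J I)) /=; last first.
    by exists (@tr I J) => f _; exact: trK.
  apply: eq_bigl => g; rewrite !inE negb_exists.
  apply/forallP/ffun_onP => [no j|no j].
    rewrite inE; apply: contra (no j) => /eqP gj.
    by apply/forallP => i; rewrite !ffunE gj ffunE.
  apply: contra (no j) => /forallP gj; apply/eqP/ffunP => i.
  by have := gj i; rewrite !ffunE.
rewrite (eq_card (B := ffun_on (predC1 full))) ?card_ffun_on//.
by rewrite cardC1 card_ffun card_bool.
Qed.

Context {R : realType}.

(** The left side is the probability of a full column under independent fair signs; the complement
    is counted. *)
Lemma card_full_column (n N : nat) :
  #|[pred rho : {ffun 'I_n -> {ffun 'I_N -> bool}} | [exists j, [forall i, rho i j]]]|%:R
  * (2 ^- N) ^+ n = 1 - (1 - 2 ^- n) ^+ N :> R.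
Proof.
set G := [pred _ | _].
have cG : (#|G| + (2 ^ n).-1 ^ N = 2 ^ (N * n))%N.
  have := cardC G; rewrite card_ffun card_ffun !card_ord card_bool -expnM => <-.
  by have := card_no_full_column 'I_n 'I_N; rewrite !card_ord => <-.
have -> : #|G|%:R = 2 ^+ (N * n) - (2 ^+ n - 1) ^+ N :> R.
  rewrite -natrX -cG natrD natrX -subn1 natrB ?expn_gt0// natrX; ring.
have n2 : (2 ^+ n : R) != 0 by rewrite expf_neq0.
rewrite mulrBl exprVn -exprM divff ?expf_neq0//; congr (_ - _).
by rewrite mulnC exprM -exprVn -exprMn; congr (_ ^+ _); rewrite mulrBl divff// mul1r.
Qed.

(** Take the power 4^n of 1 - x <= exp(-x) at x = 2^-n, since 4^n 2^-n = 2^n. *)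
Lemma no_full_column_le_expR (n : nat) :
  (1 - 2 ^- n) ^+ (4 ^ n) <= expR (- 2 ^+ n) :> R.
Proof.
have n2 : (2 ^+ n : R) != 0 by rewrite expf_neq0.
have -> : - 2 ^+ n = (- 2 ^- n) *+ (4 ^ n) :> R.
  by rewrite -[RHS]mulr_natr natrX (_ : 4%:R = 2 * 2 :> R) ?exprMn; [field|ring].
rewrite -[X in expR X]mulr_natl expRM_natl.
rewrite lerXn2r ?nnegrE ?expR_ge0 ?expR_ge1Dx//.
by rewrite subr_ge0 invf_le1 ?exprn_gt0// exprn_ege1// ler1n.
Qed.

End sign_patterns.

(** * Generators of the cone in the kernel of the random matrix *)

Section cone_kernel.
Context {R : realType} {N : nat}.

(* For r j = true the j-th generator of the cone is orthogonal to z. *)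
Definition sign_event (K : R) (r : {ffun 'I_N -> bool}) : set 'cV[R]_(N + 1) :=
  [set z | z (rshift N 0) 0 != 0 /\
    forall j, z (lshift 1 j) 0 = (-1) ^+ r j * (K * z (rshift N 0) 0)].

Lemma measurable_sign_event K r : measurable (sign_event K r).
Proof.
have mc i : measurable_fun setT (fun z : 'cV[R]_(N + 1) => z i 0).
  exact: measurable_coord.
have meq (f g : 'cV[R]_(N + 1) -> R) : measurable_fun setT f ->
    measurable_fun setT g -> measurable [set z | f z = g z].
  move=> mf mg; have := measurable_fun_eqr mf mg.
  move=> /(_ measurableT [set true] I); rewrite setTI.
  rewrite (_ : _ @^-1` _ = [set z | f z = g z])//.
  by apply/seteqP; split => z /= /eqP.
rewrite (_ : sign_event K r = ~` [set z | z (rshift N 0) 0 = 0] `&`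
  \bigcap_(j : 'I_N) [set z | z (lshift 1 j) 0 = (-1) ^+ r j * (K * z (rshift N 0) 0)]).
  apply: measurableI; first by apply: measurableC; apply: meq.
  apply: fin_bigcap_measurable => [|j _]; first exact: finite_finset.
  by apply: meq => //; apply: measurable_funM => //; exact: measurable_funM.
apply/seteqP; split => z /=.
  by move=> [z0 zj]; split => [|j _]; [exact/eqP|exact: zj].
by move=> [/eqP z0 zj]; split => // j; exact: zj.
Qed.

(** As K z_0 is nonzero, the sign of each coordinate relative to it determines the pattern. Hence
    the events of distinct patterns are disjoint. *)
Lemma sign_event_inj K r r' z : K != 0 ->
  sign_event K r z -> sign_event K r' z -> r = r'.
Proof.
move=> K0 [z0 zr] [_ zr']; apply/ffunP => j.
have Kz0 : K * z (rshift N 0) 0 != 0 by rewrite mulf_neq0.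
have := zr' j; rewrite zr.
case: (r j) (r' j) => -[] //=; rewrite expr0 expr1 => h;
  by case/eqP: Kz0; lra.
Qed.

Lemma norm2_scale p (c : R) (u : 'cV[R]_p) : norm2 (c *: u) = `|c| * norm2 u.
Proof.
rewrite /norm2 -sqrtr_sqr -sqrtrM ?sqr_ge0// mulr_sumr; congr Num.sqrt.
by apply: eq_bigr => i _; rewrite mxE exprMn.
Qed.

Lemma norm2_cone_gen_gt0 (K : R) j : 0 < norm2 (cone_gen K j : 'cV[R]_(N + 1)).
Proof.
rewrite sqrtr_gt0 (bigD1 (lshift 1 j))//= col_mxEu mxE !eqxx expr1n ltr_wpDr//.
by rewrite sumr_ge0// => i _; exact: sqr_ge0.
Qed.

Lemma inf_sqnorm_kernel n (K : R) j (M : 'M[R]_(n, N + 1)) :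
  M *m cone_gen K j = 0 -> inf_sqnorm M (cone K `&` unit_sphere) = 0%E.
Proof.
move=> Mj; apply/inf_sqnorm_eq0P => k.
have c0 := norm2_cone_gen_gt0 K j; set c := norm2 _ in c0.
(* The normalised generator serves for every k. *)
exists (c^-1 *: cone_gen K j).
  split; last first.
    by rewrite /unit_sphere/= norm2_scale gtr0_norm ?invr_gt0// mulVf// gt_eqF.
  exists (fun i => c^-1 * (i == j)%:R) => [i|]; first by rewrite mulr_ge0// invr_ge0 ltW.
  rewrite (bigD1 j)//= eqxx mulr1 big1 ?addr0// => i /negbTE ->.
  by rewrite mulr0 scale0r.
rewrite -scalemxAr Mj scaler0 norm2_sqr big1 ?invr_gt0//.
by move=> i _; rewrite mxE expr0n.
Qed.

Lemma sign_event_kernel n (K : R) j (M : 'M[R]_(n, N + 1))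
    (rho : {ffun 'I_n -> {ffun 'I_N -> bool}}) :
  (forall i, sign_event K (rho i) (row i M)^T) -> (forall i, rho i j) ->
  M *m cone_gen K j = 0.
Proof.
move=> Mrho rhoj; apply/colP => i.
have Mij : M i (lshift 1 j) = - (K * M i (rshift N 0)).
  by have [_ /(_ j)] := Mrho i; rewrite !mxE rhoj expr1 mulN1r.
rewrite [LHS]mxE [RHS]mxE big_split_ord big_ord1 col_mxEd mxE.
rewrite (bigD1 j)//= col_mxEu mxE !eqxx mulr1 Mij big1 => [|k kj].
  by ring.
by rewrite col_mxEu mxE (negbTE kj) mulr0.
Qed.

End cone_kernel.

Section kernel_probability.
Context {R : realType} {n N : nat}.
Context {d : measure_display} {T : measurableType d} {P : probability T R}.
Context {X : {RV P >-> 'M[R]_(n, N + 1)}} {K : R}.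
Hypothesis K0 : K != 0.
Hypothesis indep : mutually_independent P (fun (i : 'I_n) w => (row i (X w))^T).
Hypothesis law : forall (i : 'I_n) (r : {ffun 'I_N -> bool}),
  P [set w | sign_event K r (row i (X w))^T] = (2 ^- N)%:E.

Let E (rho : {ffun 'I_n -> {ffun 'I_N -> bool}}) : set T :=
  [set w | forall i, sign_event K (rho i) (row i (X w))^T].

Lemma measurable_row_tr {m p : nat} (i : 'I_m) :
  measurable_fun setT (fun M : 'M[R]_(m, p) => (row i M)^T).
Proof.
apply: (@measurability _ _ _ ('cV[R]_p : measurableType _) _ _
  (@measurable_entries _ R p 1) erefl) => _ [_ [i' [j' [B [mB ->]]]] <-].
rewrite setTI; apply: sub_sigma_algebra; exists i, i', B; split => //.
by apply/seteqP; split => M /=; rewrite !mxE.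
Qed.

Let measurable_E rho : measurable (E rho).
Proof.
rewrite (_ : E rho = \bigcap_(i : 'I_n)
  (setT `&` (fun w => (row i (X w))^T) @^-1` sign_event K (rho i))).
  apply: fin_bigcap_measurable => [|i _]; first exact: finite_finset.
  have mX : measurable_fun setT (fun w => (row i (X w))^T).
    by apply: (measurableT_comp (measurable_row_tr i)).
  by apply: mX => //; exact: measurable_sign_event.
by apply/seteqP; split => w Ew i; [split => //; exact: Ew|case: (Ew i I)].
Qed.

Let prob_E rho : P (E rho) = ((2 ^- N) ^+ n)%:E.
Proof.
have := indep (fun i => sign_event K (rho i)) (fun i => measurable_sign_event K (rho i)).
rewrite /E => ->.
under eq_bigr do rewrite law.
by rewrite prodEFin prodr_const card_ord.
Qed.

(** The events [E rho] are disjoint and equally likely. Those with a full column j put generator j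
    in the kernel, so the sum of their probabilities is a lower bound. *)
Lemma prob_inf_sqnorm_cone :
  ((1 - (1 - 2 ^- n) ^+ N)%:E <=
   P [set w | inf_sqnorm (X w) (cone K `&` unit_sphere) = 0%E])%E.
Proof.
pose G := [pred rho : {ffun 'I_n -> {ffun 'I_N -> bool}} |
  [exists j, [forall i, rho i j]]].
have triv : trivIset [set` G] E.
  move=> rho rho' _ _ [w [Ew Ew']]; apply/ffunP => i.
  exact: sign_event_inj K0 (Ew i) (Ew' i).
have <- : P (\bigcup_(rho in [set` G]) E rho) = (1 - (1 - 2 ^- n) ^+ N)%:E.
  rewrite (measure_fin_bigcup _ finite_finset triv)//.
  rewrite -(@bigfs _ _ _ _ (index_enum _) G) ?index_enum_uniq//; last first.
    by move=> rho _; rewrite mem_index_enum.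
  rewrite (eq_bigr (fun=> ((2 ^- N) ^+ n)%:E)) => [|rho _]; last exact: prob_E.
  by rewrite sumEFin sumr_const -[(_ *+ #|_|)%R]mulr_natl card_full_column.
apply: le_measure; rewrite ?inE.
- by apply: fin_bigcup_measurable => //; exact: finite_finset.
- rewrite -[X in measurable X]setTI.
  have mX : measurable_fun setT X by [].
  exact: (mX measurableT _ (measurable_inf_sqnorm_eq0 _)).
- move=> w [rho /existsP[j /forallP rhoj] Ew].
  by apply: (@inf_sqnorm_kernel _ _ _ _ j); exact: sign_event_kernel Ew rhoj.
Qed.

End kernel_probability.

(** * The heavy-tailed vector and its properties *)

Section heavy_tailed_signs.
Context {R : realType} {N : nat}.

Local Notation signs := (bool * {ffun 'I_N -> bool})%type.

Definition no_sign : signs := (false, [ffun=> false]).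

Local Notation T := (discrete (0%N, no_sign)).
Local Notation P := (@geom_unif R _ no_sign).

Variable K : R.
Hypothesis K1 : 1 <= K.

Let K0 : 0 < K. Proof. exact: lt_le_trans K1. Qed.

Definition sign_vec (r : {ffun 'I_N -> bool}) : 'cV[R]_(N + 1) :=
  col_mx (\col_j (K * (-1) ^+ r j)) (const_mx 1).

(* Level k has mass of order 8^-k and height 2^k, which makes the tails of order
   t^-3: finite second moment, infinite fourth moment. *)
Definition heavy (t : T) : 'cV[R]_(N + 1) :=
  (2 ^+ t.1 * (-1) ^+ t.2.1) *: sign_vec t.2.2.

HB.instance Definition _ := isMeasurableFun.Build _ _ _ _ heavy
  (@measurable_fun_discrete _ _ _ _ heavy setT).

Let Z : {RV P >-> 'cV[R]_(N + 1)} := heavy.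

(** The absolute value of a coordinate of [sign_vec] is the same for all patterns, so that of
    [heavy] varies with the level only. *)
Definition coord_size (i : 'I_(N + 1)) : R := if fintype.split i is inl _ then K else 1.

Lemma coord_size_ge1 i : 1 <= coord_size i.
Proof. by rewrite /coord_size; case: fintype.split. Qed.

Let coord_size_gt0 i : 0 < coord_size i.
Proof. exact: lt_le_trans (coord_size_ge1 i). Qed.

Lemma normr_sign_vec r i : `|sign_vec r i 0| = coord_size i.
Proof.
rewrite /sign_vec /coord_size mxE; case: fintype.split => j; rewrite mxE ?normr1//.
by rewrite normrM normr_sign mulr1 gtr0_norm.
Qed.

Lemma normr_heavy (t : T) i : `|heavy t i 0| = coord_size i * 2 ^+ t.1.
Proof.
by rewrite mxE normrM normr_sign_vec normrM normr_sign mulr1 mulrC ger0_norm// exprn_ge0.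
Qed.

Lemma coord_size_le i : coord_size i <= K.
Proof. by rewrite /coord_size; case: fintype.split. Qed.

Lemma integrable_heavy i : P.-integrable setT (EFin \o (fun t => heavy t i 0)).
Proof.
apply: (@integrable_geom_unif _ _ _ _ K) => t; rewrite normr_heavy.
rewrite ler_pM ?exprn_ge0 ?coord_size_le//; first exact: ltW.
by rewrite lerXn2r// ?nnegrE// ler_nat.
Qed.

Lemma integrable_heavyM i j :
  P.-integrable setT (EFin \o (fun t => heavy t i 0 * heavy t j 0)).
Proof.
apply: (@integrable_geom_unif _ _ _ _ (K * K)) => t; rewrite normrM !normr_heavy.
rewrite mulrACA -exprMn (_ : 2 * 2 = 4 :> R); last by ring.
by rewrite ler_wpM2r ?exprn_ge0// ler_pM ?coord_size_le// ltW.
Qed.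

Lemma centered_heavy : centered P Z.
Proof.
move=> i; rewrite unlock.
(* The involution flips the global sign and keeps the pattern. *)
apply: (@expectation_geom_unif_odd _ _ _ (fun t => heavy t i 0) (fun x => (~~ x.1, x.2))).
- exact: integrable_heavy.
- by move=> [s r]; rewrite /= negbK.
- by move=> k [s r]; rewrite !mxE/= signrN mulrN mulNr.
Qed.

Lemma finite_covariance_heavy : finite_covariance P Z.
Proof.
move=> i j; apply: covariance_fin_num.
- by apply/Lfun1_integrable; exact: integrable_heavy.
- by apply/Lfun1_integrable; exact: integrable_heavy.
- by apply/Lfun1_integrable; exact: integrable_heavyM.
Qed.

Lemma infinite_fourth_moment_heavy : infinite_fourth_moment P Z.
Proof.
move=> i; rewrite unlock; apply: integral_geom_unif_pinfty => t.
rewrite normr_heavy exprMn -exprM mulnC exprM (_ : 2 ^+ 4 = 16 :> R); last by ring.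
by rewrite ler_peMl ?exprn_ge0// exprn_ege1// coord_size_ge1.
Qed.

(** The tail at t is 8^-k for the least k with t <= a 2^k. Cubing a 2^(k-1) <= t <= a 2^k compares
    it with t^-3 up to a factor 8. *)
Lemma polynomial_tails_heavy : polynomial_tails P Z.
Proof.
move=> i; set a := coord_size i; have a0 : 0 < a := coord_size_gt0 i.
(* The threshold 2 a excludes k = 0, so that level k - 1 exists. *)
exists (a ^+ 3 / 8), (a ^+ 3), 3, (2 * a); split => //.
- by rewrite divr_gt0 ?exprn_gt0.
- by rewrite ler_piMr ?exprn_ge0 ?(ltW a0)// invf_le1// ler1n.
- by rewrite mulr_gt0.
move=> t ta; have t0 : 0 < t by lra.
have /ex_minnP[k tk kmin] : exists k, t <= a * 2 ^+ k.
  exists (Num.truncn (t / a)).+1; rewrite -ler_pdivrMl// mulrC.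
  by rewrite (le_trans (ltW (truncnS_gt _)))// -natrX ler_nat ltnW// ltn_expl.
have tailE : P [set w | t <= `|Z w i 0|] = (8 ^- k)%:E.
  rewrite (_ : [set _ | _] = [set w : T | (k <= w.1)%N && (predT : pred signs) w.2]).
    apply: etrans (geom_unif_tail no_sign k predT) _.
    rewrite divff ?mulr1// pnatr_eq0 -lt0n; apply/card_gt0P.
    by exists no_sign.
  apply/seteqP; split => w /=; rewrite andbT normr_heavy; first exact: kmin.
  by move=> kw; rewrite (le_trans tk)// ler_pM2l// ler_weXn2l// ler1n.
rewrite /= tailE.
have -> : t `^ (- 3) = (t ^+ 3)^-1 by rewrite powRN powR_mulrn// ltW.
rewrite !lee_fin; split.
  case: k tk kmin {tailE} => [|k] tk kmin.
    by move: tk; rewrite expr0 => ?; lra.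
  have tk' : a * 2 ^+ k <= t.
    by rewrite leNgt; apply/negP => /ltW /kmin; rewrite ltnn.
  rewrite ler_pdivrMr ?exprn_gt0// [leRHS]mulrC ler_pdivlMr ?exprn_gt0//.
  have : (a * 2 ^+ k) ^+ 3 <= t ^+ 3.
    by rewrite lerXn2r ?nnegrE ?mulr_ge0 ?exprn_ge0 ?(ltW a0) ?(ltW t0)//.
  rewrite exprMn exprAC (_ : 2 ^+ 3 = 8 :> R); last by ring.
  by rewrite [8 ^+ k.+1]exprS; lra.
rewrite ler_pdivlMr ?exprn_gt0// mulrC ler_pdivrMr ?exprn_gt0//.
have : t ^+ 3 <= (a * 2 ^+ k) ^+ 3.
  by rewrite lerXn2r ?nnegrE ?mulr_ge0 ?exprn_ge0 ?(ltW a0) ?(ltW t0)//.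
by rewrite exprMn exprAC (_ : 2 ^+ 3 = 8 :> R); last by ring.
Qed.

Lemma card_snd_pred (G : pred {ffun 'I_N -> bool}) :
  #|[pred x : signs | G x.2]| = (2 * #|G|)%N.
Proof.
rewrite -card_bool -cardX; apply: eq_card => -[s r].
by rewrite !inE.
Qed.

Lemma geom_unif_snd (G : pred {ffun 'I_N -> bool}) :
  P [set t | G t.2.2] = (#|G|%:R / #|{ffun 'I_N -> bool}|%:R)%:E.
Proof.
have := @geom_unif_tail R _ no_sign 0 (fun x => G x.2).
rewrite (_ : [set _ | _] = [set t | G t.2.2])// => ->.
rewrite expr0 invr1 mul1r card_snd_pred card_prod card_bool !natrM.
by rewrite -mulf_div divff// mul1r.
Qed.

Lemma inner_heavy (t : T) (v : 'cV[R]_(N + 1)) :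
  inner (heavy t) v = 2 ^+ t.1 * (-1) ^+ t.2.1 *
    sign_sum (v (rshift N 0) 0) (fun j => K * v (lshift 1 j) 0)
      (index_enum 'I_N) t.2.2.
Proof.
rewrite /inner /sign_sum big_split_ord/= big_ord1 mulrDr addrC mulr_sumr.
congr (_ + _); first by rewrite mxE col_mxEd mxE mulr1.
by apply: eq_bigr => j _; rewrite mxE col_mxEu mxE; ring.
Qed.

(** The level factor is at least 1, and K >= 1 makes [sq_weight] at least the squared norm of v. So
    2 S^2 >= [sq_weight] suffices, which [card_sign_sum_ge] gives with probability 1/12. *)
Lemma small_ball_heavy : small_ball P Z (Num.sqrt 2)^-1 12^-1.
Proof.
apply: le_ereal_inf_tmp => _ [v _ <-].
pose a := v (rshift N 0) 0; pose b j := K * v (lshift 1 j) 0.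
pose S := sign_sum a b (index_enum 'I_N).
pose G := [pred r | sq_weight a b (index_enum 'I_N) <= 2 * S r ^+ 2].
apply: (@le_trans _ _ (P [set t | G t.2.2])).
  rewrite geom_unif_snd lee_fin ler_pdivlMr; last first.
    by rewrite ltr0n; apply/card_gt0P; exists [ffun=> false].
  by have := @card_sign_sum_ge R _ a b _ (index_enum_uniq 'I_N); rewrite -/S -/G; lra.
apply: le_measure; rewrite ?inE// => t /= Gt.
rewrite inner_heavy normrM normrM normr_sign mulr1 ger0_norm ?exprn_ge0// -/a -/b -/S.
apply: (@le_trans _ _ `|S t.2.2|); last by rewrite ler_peMl// exprn_ege1// ler1n.
rewrite -(ler_pM2l (_ : 0 < Num.sqrt 2)) ?sqrtr_gt0// mulVKf ?sqrtr_eq0 -?ltNge//.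
rewrite -sqrtr_sqr -sqrtrM// ler_wsqrtr// (le_trans _ Gt)//.
rewrite big_split_ord/= big_ord1 addrC lerD2l ler_sum// => j _.
rewrite /b exprMn ler_peMl ?sqr_ge0// exprn_ege1//.
Qed.

Lemma prob_sign_event_heavy r : P [set w | sign_event K r (Z w)] = (2 ^- N)%:E.
Proof.
(* Each value lies in the event of its own pattern; disjointness then identifies the event of [r]
   with the labels of pattern [r]. *)
have eventZ t : sign_event K t.2.2 (heavy t).
  have nz : 2 ^+ t.1 * (-1) ^+ t.2.1 != 0 :> R by rewrite mulf_neq0 ?expf_neq0 ?signr_eq0.
  split; rewrite mxE col_mxEd mxE mulr1// => j.
  by rewrite mxE col_mxEu mxE; ring.
have -> : [set w | sign_event K r (Z w)] = [set t : T | pred1 r t.2.2].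
  apply/seteqP; split => t /= => [tr|/eqP <-]; last exact: eventZ.
  by apply/eqP; apply: sign_event_inj (eventZ t) tr; rewrite gt_eqF.
rewrite geom_unif_snd card1 card_ffun card_bool card_ord natrX.
by rewrite mul1r.
Qed.

End heavy_tailed_signs.

Theorem theorem2p2 (R : realType) (n : nat) (n_ge1 : (1 <= n)%N) :
  let alpha0 : R := (Num.sqrt 2)^-1 in
  let beta0 : R := 12^-1 in
  let p := (4 ^ n + 1)%N in
  exists (C : set 'cV[R]_p) (d : measure_display) (T : measurableType d)
         (P : probability T R) (Z : {RV P >-> 'cV[R]_p}),
    let A := C `&` unit_sphere in
    [/\ polyhedral_cone C /\ centered P Z,
        [/\ finite_covariance P Z, polynomial_tails P Z &
            infinite_fourth_moment P Z],
        small_ball P Z alpha0 beta0,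
        forall (d' : measure_display) (T' : measurableType d')
               (P' : probability T' R) (g : {RV P' >-> 'cV[R]_p}),
          standard_gaussian P' g -> (gaussian_width P' g A < 2%:E)%E
      & forall (d' : measure_display) (T' : measurableType d')
               (P' : probability T' R) (X : {RV P' >-> 'M[R]_(n, p)}),
          rows_iid_copies P Z P' X ->
          ((1 - expR (- 2 ^+ n))%:E <=
           P' [set w | inf_sqnorm (X w) A = 0%E])%E].
Proof.
move=> alpha0 beta0 p.
(* With K = N the width bound (1 + N / K) exp(-1/2) becomes 2 exp(-1/2). *)
pose K : R := (4 ^ n)%:R.
have K1 : 1 <= K by rewrite ler1n expn_gt0.
have K0 : 0 < K by exact: lt_le_trans K1.
exists (cone K), default_measure_display, _, (@geom_unif R _ no_sign), (heavy K).
split.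
- by split; [exact: polyhedral_cone_cone|exact: centered_heavy].
- split; [exact: finite_covariance_heavy|exact: polynomial_tails_heavy|].
  exact: infinite_fourth_moment_heavy.
- exact: small_ball_heavy.
- move=> d' T' P' g gauss.
  apply: le_lt_trans (@gaussian_width_cone _ (4 ^ n) _ _ _ g _ K0 gauss) _.
  by rewrite lte_fin divff ?gt_eqF// -[ltRHS]mulr1 ltr_pM2l//.
- move=> d' T' P' X [indep law].
  apply: le_trans (@prob_inf_sqnorm_cone _ _ (4 ^ n) _ _ _ X _ (lt0r_neq0 K0) indep _).
    by rewrite lee_fin lerD2l lerN2 no_full_column_le_expR.
  move=> i r; apply: etrans (law i _ (@measurable_sign_event R (4 ^ n) K r)) _.
  exact: prob_sign_event_heavy.
Qed.
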